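(* Let $\mathcal{H}$ be a Hilbert space, and let $A=\{A_a\}_{a\in\Omega_A}$ and $B=\{B_b\}_{b\in\Omega_B}$ be POVMs on $\mathcal{H}$ with finite outcome sets. For any POVM $F=\{F_x\}_{x\in\Omega}$ on $\mathcal{H}$ with finite outcome set $\Omega$ and any functions $f_A:\Omega\to\Omega_A$ and $f_B:\Omega\to\Omega_B$, $$2D_{d_1}(A,f_A(F))\,D_{d_1}(B,f_B(F))+D_{d_1}(A,f_A(F))+D_{d_1}(B,f_B(F))$$ $$+2\bigl(2D_{d_1}(A,f_A(F))+V_1(A)\bigr)^{1/2}\bigl(2D_{d_1}(B,f_B(F))+V_1(B)\bigr)^{1/2}\ \ge\ \max_{\Delta_A\subset\Omega_A,\,\Delta_B\subset\Omega_B}\Bigl\Vert\sum_{a\in\Delta_A}\sum_{b\in\Delta_B}[A_a,B_b]\Bigr\Vert,$$ where $V_1(A):=\max_{\Delta_A\subset\Omega_A}\bigl\Vert\sum_{a\in\Delta_A}A_a\bigl(\mathbf{1}-\sum_{a'\in\Delta_A}A_{a'}\bigr)\bigr\Vert$ and similarly $V_1(B):=\max_{\Delta_B\subset\Omega_B}\bigl\Vert\sum_{b\in\Delta_B}B_b\bigl(\mathbf{1}-\sum_{b'\in\Delta_B}B_{b'}\bigr)\bigr\Vert$.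
   Context: $\mathcal{H}$ is a (nonzero, complex) Hilbert space, $\Vert\cdot\Vert$ is the operator norm on $\mathbf{B}(\mathcal{H})$, and $[X,Y]=XY-YX$. A positive operator valued measure (POVM) with finite outcome set $\Omega$ is a family $F=\{F_x\}_{x\in\Omega}$ of bounded operators on $\mathcal{H}$ with $0\le F_x\le\mathbf{1}$ and $\sum_{x\in\Omega}F_x=\mathbf{1}$. For a function $f:\Omega\to\Omega'$ ($\Omega'$ finite), $f(F)=\{f(F)_y\}_{y\in\Omega'}$ is the POVM $f(F)_y:=\sum_{x\in\Omega:\,f(x)=y}F_x$. For a state $\omega$ (positive linear functional on $\mathbf{B}(\mathcal{H})$ with $\omega(\mathbf{1})=1$), $P^\omega_A(a):=\omega(A_a)$. For probability distributions $p,q$ on a finite set $\Omega$, $d_1(p,q):=\frac12\sum_{x\in\Omega}|p(x)-q(x)|$. For POVMs $A,A'$ with the same finite outcome set $\Omega$, $D_{d_1}(A,A'):=\sup_\omega d_1(P^\omega_A,P^\omega_{A'})$, the supremum being over all states; equivalently $D_{d_1}(A,A')=\max_{\Delta\subset\Omega}\Vert\sum_{a\in\Delta}A_a-\sum_{a\in\Delta}A'_a\Vert$. *)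

(* Defs.v *)
From HB Require Import structures.
From mathcomp Require Import all_boot all_order all_algebra.
From mathcomp Require Import sesquilinear complex.
From mathcomp Require Import boolp classical_sets functions reals topology.
From mathcomp Require Import normedtype.

Set Implicit Arguments.
Unset Strict Implicit.
Unset Printing Implicit Defensive.

Import Order.TTheory GRing.Theory Num.Theory.
Import numFieldNormedType.Exports.

Local Open Scope complex_scope.
Local Open Scope classical_set_scope.
Local Open Scope ring_scope.

(* The inner product is linear in its first argument and conjugate-linear in
   its second. *)
HB.mixin Record CompleteNormedModule_isHilbert (R : realType) H
    & CompleteNormedModule R[i] H := {
  inner : {dot H for Num.conj} ;
  normr_inner : forall x : H, `|x| ^+ 2 = inner x x
}.

#[short(type="hilbertType")]
HB.structure Definition Hilbert (R : realType) :=
  {H of CompleteNormedModule R[i] H & CompleteNormedModule_isHilbert R H}.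

Section BoundedOperators.
Variables (R : realType) (V : normedModType R[i]).

Definition bounded_linear : {pred (V -> V)} :=
  [pred f | `[< linear f /\ exists M : R, forall x, `|f x| <= M%:C * `|x| >]].

Lemma bounded_linearP (f : V -> V) :
  reflect (linear f /\ exists M : R, forall x, `|f x| <= M%:C * `|x|)
          (f \in bounded_linear).
Proof. exact: asboolP. Qed.

Record boundedOp := BoundedOp {
  boundedOp_fun :> V -> V ;
  boundedOp_subproof : boundedOp_fun \in bounded_linear
}.

HB.instance Definition _ := [isSub for boundedOp_fun].
HB.instance Definition _ := [Choice of boundedOp by <:].

Lemma bounded_linear_submod_closed : submod_closed bounded_linear.
Proof.
split.
  apply/bounded_linearP; split; first by move=> a x y; rewrite scaler0 addr0.
  by exists 0 => x; rewrite normr0 mul0r.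
move=> a f g /bounded_linearP[lf [M hM]] /bounded_linearP[lg [N hN]].
apply/bounded_linearP; split.
  move=> b x y; rewrite !fctE lf lg !scalerDr !scalerA (mulrC b) -!addrA.
  by congr (_ + _); rewrite addrCA.
exists (complex.Re `|a| * M + N) => x.
have aE : (complex.Re `|a|)%:C = `|a| by apply/RRe_real/normr_real.
rewrite rmorphD rmorphM /= aE mulrDl -mulrA (le_trans (ler_normD _ _))//.
by rewrite lerD// normrZ ler_wpM2l.
Qed.

HB.instance Definition _ :=
  GRing.isSubmodClosed.Build R[i] (V -> V) bounded_linear
    bounded_linear_submod_closed.
HB.instance Definition _ := [SubChoice_isSubLmodule of boundedOp by <:].

Lemma boundedOp_linear (S : boundedOp) : linear S.
Proof. by have /bounded_linearP[] := boundedOp_subproof S. Qed.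

HB.instance Definition _ (S : boundedOp) :=
  GRing.isLinear.Build R[i] V V *:%R S (boundedOp_linear S).

Lemma boundedOp_bounded (S : boundedOp) :
  exists M : R, forall x, `|S x| <= M%:C * `|x|.
Proof. by have /bounded_linearP[] := boundedOp_subproof S. Qed.

Lemma id_bounded_linear : (fun x => x) \in bounded_linear.
Proof. by apply/bounded_linearP; split=> //; exists 1 => x; rewrite mul1r. Qed.

Lemma comp_bounded_linear (S T : boundedOp) :
  (fun x => S (T x)) \in bounded_linear.
Proof.
apply/bounded_linearP; split; first by move=> a x y; rewrite !linearP.
have [M hM] := boundedOp_bounded S; have [N hN] := boundedOp_bounded T.
have hM' x : `|S x| <= `|M|%:C * `|x|.
  by rewrite (le_trans (hM _))// ler_wpM2r// lecR ler_norm.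
exists (`|M| * N) => x; rewrite (le_trans (hM' _))// rmorphM -mulrA.
by rewrite ler_wpM2l// lecR.
Qed.

Definition oneOp : boundedOp := BoundedOp id_bounded_linear.
Definition mulOp (S T : boundedOp) : boundedOp :=
  BoundedOp (comp_bounded_linear S T).

Lemma boundedOpP (S T : boundedOp) : (forall x, S x = T x) -> S = T.
Proof. by move=> ST; apply/val_inj/funext. Qed.

Lemma addOpE (S T : boundedOp) x : (S + T) x = S x + T x.
Proof. by []. Qed.

Let mulOpA : associative mulOp. Proof. by move=> *; exact: boundedOpP. Qed.
Let mul1Op : left_id oneOp mulOp. Proof. by move=> *; exact: boundedOpP. Qed.
Let mulOp1 : right_id oneOp mulOp. Proof. by move=> *; exact: boundedOpP. Qed.
Let mulOpDl : left_distributive mulOp +%R.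
Proof. by move=> *; exact: boundedOpP. Qed.
Let mulOpDr : right_distributive mulOp +%R.
Proof.
by move=> S T U; apply: boundedOpP => x; exact: (linearD S).
Qed.

HB.instance Definition _ :=
  GRing.Zmodule_isPzRing.Build boundedOp mulOpA mul1Op mulOp1 mulOpDl mulOpDr.

(* The norm of V takes its (real) values in R[i], hence the real part. *)
Definition opnorm (S : boundedOp) : R :=
  sup [set complex.Re `|S x| | x in [set x : V | `|x| <= 1]].

Definition commutator (S T : boundedOp) : boundedOp := S * T - T * S.

End BoundedOperators.

Section Povm.
Variables (R : realType) (H : hilbertType R).

(* In R[i], 0 <= z means that z is real and nonnegative. *)
Definition positive_op (S : boundedOp H) : Prop :=
  forall x : H, 0 <= inner (S x) x.

Definition le_op (S T : boundedOp H) : Prop := positive_op (T - S).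

Record povm (Omega : finType) := Povm {
  effect :> Omega -> boundedOp H ;
  effect_ge0 : forall x, le_op 0 (effect x) ;
  effect_le1 : forall x, le_op (effect x) 1 ;
  effect_sum : \sum_x effect x = 1
}.

Lemma positive_op_sum (I : finType) (P : pred I) (F : I -> boundedOp H) :
  (forall i, P i -> positive_op (F i)) -> positive_op (\sum_(i | P i) F i).
Proof.
move=> F0; apply: (big_ind positive_op) => //.
- by move=> x; rewrite (linear0l inner) lexx.
- move=> S T S0 T0 x; rewrite addOpE (linearDl inner) addr_ge0//.
  + exact: S0.
  + exact: T0.
Qed.

Section Pushforward.
Variables (Omega Omega' : finType) (f : Omega -> Omega') (F : povm Omega).

Definition pushforward_effect (y : Omega') : boundedOp H :=
  \sum_(x | f x == y) F x.

Let effect_positive x : positive_op (F x).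
Proof. by have := effect_ge0 F x; rewrite /le_op subr0. Qed.

Let pushforward_ge0 y : le_op 0 (pushforward_effect y).
Proof. by rewrite /le_op subr0; apply: positive_op_sum. Qed.

Let pushforward_le1 y : le_op (pushforward_effect y) 1.
Proof.
rewrite /le_op -(effect_sum F) (bigID (fun x => f x == y)) /= addrC addrK.
exact: positive_op_sum.
Qed.

Let pushforward_sum : \sum_y pushforward_effect y = 1.
Proof. by rewrite -(effect_sum F) (partition_big f xpredT). Qed.

Definition pushforward : povm Omega' :=
  Povm pushforward_ge0 pushforward_le1 pushforward_sum.

End Pushforward.

Definition is_state (omega : {scalar boundedOp H}) : Prop :=
  (forall S, positive_op S -> 0 <= omega S) /\ omega 1 = 1.

(* omega (A a) is a real number of R[i], here read in R. *)
Definition outcome_prob (Omega : finType) (omega : {scalar boundedOp H})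
    (A : povm Omega) (a : Omega) : R :=
  complex.Re (omega (A a)).

Definition d1 (Omega : finType) (p q : Omega -> R) : R :=
  2^-1 * \sum_x `|p x - q x|.

Definition Dd1 (Omega : finType) (A A' : povm Omega) : R :=
  sup [set d1 (outcome_prob omega A) (outcome_prob omega A')
      | omega in [set omega | is_state omega]].

(* The value 0 at the bottom of the maximum is attained at Delta = set0. *)
Definition V1 (Omega : finType) (A : povm Omega) : R :=
  \big[Num.max/0]_(Delta : {set Omega})
    opnorm ((\sum_(a in Delta) A a) * (1 - \sum_(a in Delta) A a)).

End Povm.

(* Main.v *)
(* Write E, G for the effects of a pair of events of A and B, and E', G' for the
   effects of the corresponding events of f_A(F) and f_B(F). Vector states give
   |E - E'| <= D_A and |G - G'| <= D_B, and
     [E, G] = [E - E', G] + [E', G - G'] + [E', G'],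
   where bracketing with an effect does not increase the norm. As E' and G' are
   marginals of F, Cauchy-Schwarz for the positive form
   (u, v) |-> sum_w <F_w u_w, v_w> on families of vectors bounds both
   <F_(E' and G') x, y> - <E' x, G' y> and its analogue with E' and G'
   exchanged by |E'(1 - E')|^(1/2) |G'(1 - G')|^(1/2); this replaces a Naimark
   dilation of F. Finally |E'(1 - E')| <= V_1(A) + 2 D_A. *)

From HB Require Import structures.
Require Import Defs.
From mathcomp Require Import all_boot all_order all_algebra.
From mathcomp Require Import sesquilinear complex.
From mathcomp Require Import boolp classical_sets functions reals topology.
From mathcomp Require Import normedtype.
From mathcomp Require Import ring.

Import Order.TTheory GRing.Theory Num.Theory.
Import numFieldNormedType.Exports.

Local Open Scope ring_scope.

(** * Positive semidefinite sesquilinear forms *)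

Section PositiveForms.
Context {C : numClosedFieldType} {V : lmodType C}.
Variable f : V -> V -> C.
Hypothesis f_linearl : forall a u u' v, f (a *: u + u') v = a * f u v + f u' v.
Hypothesis f_linearr :
  forall a u v v', f u (a *: v + v') = a^* * f u v + f u v'.
Hypothesis f_ge0 : forall u, 0 <= f u u.

Let f_expand a u v : f (a *: u + v) (a *: u + v) =
  a * a^* * f u u + a * f u v + a^* * f v u + f v v.
Proof. by rewrite f_linearl !f_linearr; ring. Qed.

(** Positivity makes [f w w] real; at [w = u + v] and [w = 'i *: u + v] this forces Hermitian
    symmetry. *)
Lemma psd_formC u v : f v u = (f u v)^*.
Proof.
have fR w : (f w w)^* = f w w by exact/CrealP/ger0_real.
have := fR ('i *: u + v); have := fR (1 *: u + v).
rewrite !f_expand !rmorphD !rmorphM /= !fR !(conjCi, rmorphN, conjC1) /= conjCi.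
set p := f u v; set q := f v u => e1 e2.
have ii : 'i * 'i = -1 :> C by rewrite -expr2 sqrCi.
apply: (can_inj conjCK); rewrite conjCK.
apply: (mulfI (_ : 2 != 0 :> C)); first by rewrite pnatr_eq0.
apply: subr0_eq.
move/eqP: e1; rewrite -subr_eq0 => /eqP e1.
move/eqP: e2; rewrite -subr_eq0 => /eqP e2.
(* The combination is [e1 - 'i * e2]. Since [ring] does not know the square of ['i], a multiple of
   ['i * 'i + 1] is written out. *)
have <- : 0 - 'i * 0 - ('i * 'i + 1) * (p - q + p^* - q^*) = 0 :> C.
  by rewrite ii; ring.
rewrite -[X in X - _ - _]e1 -[X in _ - 'i * X - _]e2; ring.
Qed.

(** Positivity at [u - t f(u,v) v] gives a quadratic inequality in [t >= 0], optimal at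
    [t = (f v v)^-1] when [f v v] is nonzero. *)
Lemma psd_Cauchy_Schwarz u v : `|f u v| ^+ 2 <= f u u * f v v.
Proof.
have quad t : 0 <= t ->
    0 <= f u u - 2 * t * `|f u v| ^+ 2 + t ^+ 2 * `|f u v| ^+ 2 * f v v.
  move=> t0; have := f_ge0 ((- (t * f u v)) *: v + u).
  rewrite f_expand (psd_formC u v) normCK rmorphN rmorphM /=.
  have -> : t^* = t by exact/CrealP/ger0_real.
  by congr (_ <= _); ring.
have [fv0|fv_neq0] := eqVneq (f v v) 0; last first.
  have fv_gt0 : 0 < f v v by rewrite lt_def fv_neq0 f_ge0.
  rewrite -ler_pdivrMr// -subr_ge0.
  have := quad (f v v)^-1; rewrite invr_ge0 => /(_ (ltW fv_gt0)).
  by congr (_ <= _); field.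
have [->|fuv_neq0] := eqVneq (f u v) 0.
  by rewrite normr0 expr0n mulr_ge0.
(* With [f v v = 0] the quadratic is affine in [t]; this [t] gives it the value -1, a
   contradiction. *)
have /quad : 0 <= (f u u + 1) / (2 * `|f u v| ^+ 2).
  by rewrite divr_ge0 ?addr_ge0 ?mulr_ge0 ?exprn_ge0.
rewrite fv0 mulr0 addr0 (_ : _ - _ = -1) ?oppr_ge0 ?ler10//.
by field; rewrite normr_eq0.
Qed.

End PositiveForms.

(** * Pointwise operator bounds and the operator norm *)

Section BoundedOperators.
Local Open Scope complex_scope.
Context {R : realType} {V : normedModType R[i]}.
Implicit Types (S T : boundedOp V) (c d : R).

(** Estimates are composed in this pointwise form; the supremum [opnorm] enters only through
    [opnorm_le] and [opnorm_bound]. *)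
Definition op_bound S c := forall x, `|S x| <= c%:C * `|x|.

Lemma mulOpE S T x : (S * T) x = S (T x). Proof. by []. Qed.

Lemma oneOpE (x : V) : (1 : boundedOp V) x = x. Proof. by []. Qed.

Lemma oppOpE S x : (- S) x = - S x. Proof. by []. Qed.

Lemma op_boundW {S c d} : c <= d -> op_bound S c -> op_bound S d.
Proof.
by move=> cd Sc x; rewrite (le_trans (Sc x))// ler_wpM2r// lecR.
Qed.

Lemma op_boundN {S c} : op_bound S c -> op_bound (- S) c.
Proof. by move=> Sc x; rewrite oppOpE normrN. Qed.

Lemma op_boundD {S T c d} :
  op_bound S c -> op_bound T d -> op_bound (S + T) (c + d).
Proof.
move=> Sc Td x; rewrite addOpE rmorphD mulrDl (le_trans (ler_normD _ _))//.
exact: lerD.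
Qed.

Lemma op_boundM {S T c d} : 0 <= c ->
  op_bound S c -> op_bound T d -> op_bound (S * T) (c * d).
Proof.
move=> c0 Sc Td x; rewrite mulOpE rmorphM -mulrA (le_trans (Sc _))//.
by rewrite ler_wpM2l ?lecR.
Qed.

Lemma opnorm_le {S c} : 0 <= c -> op_bound S c -> opnorm S <= c.
Proof.
move=> c0 Sc; apply: ge_sup.
  by exists (complex.Re `|S 0|), 0 => //=; rewrite normr0 ler01.
move=> _ [x /= x1 <-]; rewrite -lecR RRe_real ?normr_real//.
by rewrite (le_trans (Sc x))// ler_piMr// lecR.
Qed.

Lemma opnorm_bound S : op_bound S (opnorm S).
Proof.
have Re_norm (x : V) : (complex.Re `|x|)%:C = `|x|.
  by rewrite RRe_real ?normr_real.
have [M SM] := boundedOp_bounded S.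
move=> x; have [->|x0] := eqVneq x 0; first by rewrite raddf0 !normr0 mulr0.
have xn : 0 < `|x| by rewrite normr_gt0.
rewrite -ler_pdivrMr// (_ : _ / _ = `|S (`|x|^-1 *: x)|).
  2: by rewrite linearZ /= normrZ normfV normr_id mulrC.
rewrite -Re_norm lecR; apply: ub_le_sup.
  exists `|M| => _ [y /= y1 <-]; rewrite -lecR Re_norm (le_trans (SM y))//.
  rewrite (@le_trans _ _ (`|M|%:C * `|y|))//.
    by rewrite ler_wpM2r// lecR ler_norm.
  by rewrite ler_piMr// lecR.
exists (`|x|^-1 *: x) => //=.
by rewrite normrZ gtr0_norm ?invr_gt0// mulVf ?gt_eqF.
Qed.

End BoundedOperators.

(** * Symmetric operators, effects and their commutators *)

Section HilbertSpace.
Local Open Scope complex_scope.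
Context {R : realType} {H : hilbertType R}.
Implicit Types (S T X E : boundedOp H) (c d : R) (x y : H).

Lemma innerDl x y z : inner (x + y) z = inner x z + inner y z.
Proof. exact: (linearDl inner). Qed.

Lemma innerDr x y z : inner z (x + y) = inner z x + inner z y.
Proof. exact: (linearDr inner). Qed.

Lemma innerBl x y z : inner (x - y) z = inner x z - inner y z.
Proof. exact: (linearBl inner). Qed.

Lemma innerBr x y z : inner z (x - y) = inner z x - inner z y.
Proof. exact: (linearBr inner). Qed.

Lemma innerZl a x y : inner (a *: x) y = a * inner x y.
Proof. exact: (linearZl_LR inner). Qed.

Lemma innerZr a x y : inner x (a *: y) = a^*%R * inner x y.
Proof. exact: (linearZr_LR inner). Qed.

Lemma inner_ge0 x : 0 <= inner x x.
Proof. by rewrite -normr_inner exprn_ge0. Qed.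

Lemma inner_conj x y : inner y x = (inner x y)^*%R.
Proof. by rewrite hermC /= expr0 mul1r. Qed.

Lemma norm_inner x y : `|inner x y| <= `|x| * `|y|.
Proof.
rewrite -(@ler_pXn2r _ 2) ?nnegrE ?mulr_ge0// exprMn !normr_inner.
apply: (@psd_Cauchy_Schwarz _ _ (fun x y => inner x y)) => *.
- by rewrite linearPl.
- by rewrite linearPr.
- exact: inner_ge0.
Qed.

Definition symmetric_op S := forall x y, inner (S x) y = inner x (S y).

Lemma positive_op_symmetric S : positive_op S -> symmetric_op S.
Proof.
move=> S0 x y; rewrite [RHS]inner_conj.
apply: (@psd_formC _ _ (fun x y => inner (S x) y)) => *.
- by rewrite linearP linearPl.
- by rewrite linearPr.
- exact: S0.
Qed.

Lemma symmetric_opB S T :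
  symmetric_op S -> symmetric_op T -> symmetric_op (S - T).
Proof.
by move=> hS hT x y; rewrite !addOpE !oppOpE innerBl innerBr hS hT.
Qed.

(** Polarization turns [|S x| ^+ 2] into a difference of two values of the quadratic form of [S],
    whose bounds the parallelogram law adds up. Estimates on vector states thus become operator
    bounds. *)
Lemma numerical_range_bound S c : 0 <= c -> symmetric_op S ->
  (forall x, `|inner (S x) x| <= c%:C * `|x| ^+ 2) -> op_bound S c.
Proof.
move=> c0 symS Sc x; set v := S x.
(* Polarization at [s x] and [S x], where [s = c] is optimal if [c > 0]. *)
have polar (s : R) :
    4 * s%:C * `|v| ^+ 2 <= 2 * c%:C * (s%:C ^+ 2 * `|x| ^+ 2 + `|v| ^+ 2).
  have sR : (s%:C : R[i])^*%R = s%:C by apply/CrealP/complex_realP; exists s.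
  set u := s%:C *: x.
  have -> : 4 * s%:C * `|v| ^+ 2 =
      inner (S (u + v)) (u + v) - inner (S (u - v)) (u - v).
    have Su : S u = s%:C *: v by rewrite /u linearZ.
    have iSv : inner (S v) u = s%:C * `|v| ^+ 2.
      by rewrite symS Su innerZr sR normr_inner.
    have iSu : inner (S u) v = s%:C * `|v| ^+ 2.
      by rewrite Su innerZl normr_inner.
    rewrite (linearB S) (linearD S) !(innerBl, innerDl) !(innerBr, innerDr).
    by rewrite iSu iSv; ring.
  have parallelogram : 2 * (s%:C ^+ 2 * `|x| ^+ 2 + `|v| ^+ 2) =
      `|u + v| ^+ 2 + `|u - v| ^+ 2.
    rewrite !normr_inner !(innerBl, innerDl) !(innerBr, innerDr).
    have -> : inner u u = s%:C ^+ 2 * inner x x.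
      by rewrite innerZl innerZr sR expr2 mulrA.
    by ring.
  rewrite (mulrC 2) -mulrA parallelogram mulrDr.
  have real_form w : inner (S w) w \is Num.real.
    by rewrite CrealE -inner_conj symS.
  rewrite (le_trans (real_ler_norm _)) ?rpredB//.
  by rewrite (le_trans (ler_normB _ _))// lerD.
(* At [c = 0] the choice [s = c] only says [0 <= 0]; [s = 1] forces [S x = 0]. *)
have [c_eq0|c_neq0] := eqVneq c 0.
  have := polar 1; rewrite c_eq0 mulr0 !mul0r mulr1 pmulr_rle0// => v0.
  suff -> : `|v| = 0 by [].
  by apply/eqP; rewrite -sqrf_eq0 eq_le v0 exprn_ge0.
have cC0 : 0 < c%:C :> R[i] by rewrite ltcR lt_def c_neq0.
rewrite -(@ler_pXn2r _ 2) ?nnegrE ?mulr_ge0 ?(ltW cC0)// exprMn.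
rewrite -(ler_pM2l (_ : 0 < 2 * c%:C)) ?mulr_gt0//.
rewrite -(lerD2r (2 * c%:C * `|v| ^+ 2)) -[leRHS]mulrDr.
rewrite (le_trans _ (polar c))// [leLHS](_ : _ = 4 * c%:C * `|v| ^+ 2)//.
by ring.
Qed.

Definition is_effect E := positive_op E /\ positive_op (1 - E).

Lemma effect_bound E : is_effect E -> op_bound E 1.
Proof.
move=> [E0 E1]; apply: numerical_range_bound => //.
  exact: positive_op_symmetric.
move=> x; rewrite ger0_norm ?E0// mul1r normr_inner -subr_ge0 -innerBl.
exact: E1.
Qed.

Lemma effectC E : is_effect E -> is_effect (1 - E).
Proof. by move=> [E0 E1]; split=> //; rewrite opprB addrC subrK. Qed.

Lemma commutatorBl S T X :
  commutator (S - T) X = commutator S X - commutator T X.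
Proof. by rewrite /commutator mulrBl mulrBr !opprD addrACA. Qed.

Lemma commutatorBr S T X :
  commutator X (S - T) = commutator X S - commutator X T.
Proof. by rewrite /commutator mulrBl mulrBr !opprD addrACA. Qed.

Lemma commutator1r X : commutator X 1 = 0.
Proof. by rewrite /commutator mulr1 mul1r subrr. Qed.

(* [2 [X, E] = [X, E - (1 - E)]], and [E - (1 - E)] is a contraction. *)
Lemma commutator_effect_bound X E c : 0 <= c ->
  op_bound X c -> is_effect E -> op_bound (commutator X E) c.
Proof.
move=> c0 Xc [E0 E1]; set G := E - (1 - E).
have G1 : op_bound G 1.
  apply: numerical_range_bound => //.
    by apply: symmetric_opB; exact: positive_op_symmetric.
  (* The forms of [E] and [1 - E] are nonnegative with sum [inner x x], which bounds their
     difference. *)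
  move=> x; rewrite mul1r normr_inner.
  rewrite addOpE oppOpE innerBl (le_trans (ler_normB _ _))//.
  by rewrite !ger0_norm ?E0 ?E1// -innerDl -addOpE addrC subrK.
have XG : commutator X G = commutator X E + commutator X E.
  by rewrite /G !commutatorBr commutator1r sub0r opprK.
have XGc : op_bound (commutator X G) (c + c).
  have := op_boundM c0 Xc G1; have := op_boundM ler01 G1 Xc.
  by rewrite mulr1 mul1r => GX XG'; apply/op_boundD/op_boundN.
move=> x; rewrite -(ler_pM2l (_ : 0 < 2))//.
rewrite !mulr_natl -normrMn !mulr2n -addOpE -XG -mulrDl -rmorphD.
exact: XGc.
Qed.

(** The two factors of [E' * (1 - E')] are exchanged one at a time; each exchange costs [d], the
    other factor being a contraction. *)
Lemma effect_var_bound E E' v d : is_effect E -> is_effect E' -> 0 <= d ->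
  op_bound (E * (1 - E)) v -> op_bound (E - E') d ->
  op_bound (E' * (1 - E')) (2 * d + v).
Proof.
move=> effE effE' d0 Ev Ed.
have -> : E' * (1 - E') = (E' - E) * (1 - E') + E * (E - E') + E * (1 - E).
  have -> : E - E' = (1 - E') - (1 - E) by rewrite opprB [RHS]addrC addrA subrK.
  by rewrite mulrBl (mulrBr E (1 - E')) subrKA subrK.
apply: op_boundD => //; rewrite mulr_natl mulr2n.
apply: op_boundD.
  rewrite -[d]mulr1; apply: op_boundM => //; last exact/effect_bound/effectC.
  by rewrite -opprB; exact: op_boundN.
by rewrite -[d]mul1r; apply: op_boundM => //; exact: effect_bound.
Qed.

End HilbertSpace.

(** * Events of a POVM and the joint-measurement estimate *)

Section Povms.
Local Open Scope complex_scope.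
Context {R : realType} {H : hilbertType R}.
Implicit Types (S T X E : boundedOp H) (c d : R) (x y : H).
Context {Omega : finType}.
Implicit Types (F A : povm H Omega) (D : {set Omega}).

Definition event A D : boundedOp H := \sum_(a in D) A a.

Lemma effect_positive A a : positive_op (A a).
Proof. by have := effect_ge0 A a; rewrite /le_op subr0. Qed.

Lemma eventT A : event A [set: Omega] = 1.
Proof. by rewrite -(effect_sum A); apply: eq_bigl => a; rewrite inE. Qed.

Lemma eventC A D : event A (~: D) = 1 - event A D.
Proof.
rewrite /event -(effect_sum A) [in RHS](bigID (mem D)) /= addrAC subrr add0r.
by apply: eq_bigl => a; rewrite inE.
Qed.

Lemma event_effect A D : is_effect (event A D).
Proof.
split; last rewrite -eventC; apply: positive_op_sum => a _;
  exact: effect_positive.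
Qed.

Lemma event_symmetric A D : symmetric_op (event A D).
Proof. by apply: positive_op_symmetric; case: (event_effect A D). Qed.

Lemma event_sumE A D x : event A D x = \sum_(a in D) A a x.
Proof.
by rewrite /event; elim/big_ind2: _ => // S x' T y' <- <-; rewrite addOpE.
Qed.

Definition povm_form F (u v : Omega -> H) : R[i] :=
  \sum_w inner (F w (u w)) (v w).

Lemma povm_form_Cauchy_Schwarz F (u v : Omega -> H) :
  `|povm_form F u v| ^+ 2 <= povm_form F u u * povm_form F v v.
Proof.
apply: psd_Cauchy_Schwarz.
- move=> a u1 u2 v'; rewrite /povm_form mulr_sumr -big_split /=.
  by apply: eq_bigr => w _; rewrite linearP innerDl innerZl.
- move=> a u' v1 v2; rewrite /povm_form mulr_sumr -big_split /=.
  by apply: eq_bigr => w _; rewrite innerDr innerZr.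
- by move=> u'; apply: sumr_ge0 => w _; exact: effect_positive.
Qed.

(* The constant families, under [povm_form A], are the copy of H in a Naimark
   dilation of A; this is the component of [w |-> 1_D(w) x] orthogonal to it. *)
Definition event_residual A D x (w : Omega) : H :=
  (w \in D)%:R *: x - event A D x.

Lemma inner_suml (I : finType) (P : pred I) (h : I -> H) y :
  inner (\sum_(i | P i) h i) y = \sum_(i | P i) inner (h i) y.
Proof. exact: (linear_sumlz inner). Qed.

(** Indicator families pair to the effect of the intersection; removing their constant components
    subtracts the product term, so this is a covariance. *)
Lemma povm_form_residual F D1 D2 x y :
  povm_form F (event_residual F D1 x) (event_residual F D2 y) =
  inner (event F (D1 :&: D2) x) y - inner (event F D1 x) (event F D2 y).
Proof.
set E1 := event F D1; set E2 := event F D2.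
have split_sum w :
    inner (F w (event_residual F D1 x w)) (event_residual F D2 y w) =
    (w \in D1 :&: D2)%:R * inner (F w x) y
    - (w \in D1)%:R * inner (F w x) (E2 y)
    - (w \in D2)%:R * inner (F w (E1 x)) y + inner (F w (E1 x)) (E2 y).
  rewrite /event_residual (linearB (F w)) (linearZ_LR (F w)) innerBl innerZl.
  rewrite !innerBr !innerZr.
  by rewrite conjC_nat inE; case: (w \in D1); case: (w \in D2) => /=; ring.
have sumE D z t : \sum_w (w \in D)%:R * inner (F w z) t = inner (event F D z) t.
  rewrite event_sumE inner_suml [RHS]big_mkcond /=.
  by apply: eq_bigr => w _; case: (w \in D); rewrite ?mul1r ?mul0r.
have sum1 z t : \sum_w inner (F w z) t = inner z t.
  rewrite -[in RHS](oneOpE z) -(eventT F) -sumE.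
  by apply: eq_bigr => w _; rewrite inE mul1r.
rewrite /povm_form (eq_bigr _ (fun w _ => split_sum w)) big_split /= !sumrB.
rewrite !sumE sum1 (event_symmetric F D2 (E1 x) y) -/E1 -/E2; ring.
Qed.

Lemma op_bound_inner S c x y : op_bound S c ->
  `|inner (S x) y| <= c%:C * (`|x| * `|y|).
Proof.
by move=> Sc; rewrite (le_trans (norm_inner _ _))// mulrA ler_wpM2r.
Qed.

(** Take [y = S x] and cancel one factor [|S x|]. *)
Lemma op_bound_of_inner S c : 0 <= c ->
  (forall x y, `|inner (S x) y| <= c%:C * (`|x| * `|y|)) -> op_bound S c.
Proof.
move=> c0 Sc x; have [->|Sx_neq0] := eqVneq (S x) 0.
  by rewrite normr0 mulr_ge0// lecR.
rewrite -(@ler_pM2r _ `|S x|) ?normr_gt0// -expr2 -mulrA.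
by rewrite -[leLHS]ger0_norm ?exprn_ge0// normr_inner.
Qed.

(** For [D1 = D2 = D] the covariance is the variance [inner (E (1 - E) x) x] of [E = event F D]. *)
Lemma povm_form_residual_le F D x v :
  op_bound (event F D * (1 - event F D)) v ->
  povm_form F (event_residual F D x) (event_residual F D x) <= v%:C * `|x| ^+ 2.
Proof.
move=> Dv; have := op_bound_inner _ _ x x Dv; rewrite -expr2.
apply: le_trans; rewrite povm_form_residual finset.setIid.
rewrite -(event_symmetric F D (event F D x)) -innerBl.
rewrite mulrBr mulr1 addOpE oppOpE mulOpE real_ler_norm//.
by rewrite CrealE -inner_conj innerBl innerBr !event_symmetric.
Qed.

(** Cauchy-Schwarz for residuals: a covariance is at most the product of the standard deviations. *)
Lemma joint_event_bound F D1 D2 v1 v2 x y : 0 <= v1 -> 0 <= v2 ->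
  op_bound (event F D1 * (1 - event F D1)) v1 ->
  op_bound (event F D2 * (1 - event F D2)) v2 ->
  `|inner (event F (D1 :&: D2) x) y - inner (event F D1 x) (event F D2 y)| <=
    (Num.sqrt v1 * Num.sqrt v2)%:C * (`|x| * `|y|).
Proof.
move=> v10 v20 Dv1 Dv2; rewrite -povm_form_residual.
have s0 : 0 <= (Num.sqrt v1 * Num.sqrt v2)%:C.
  by rewrite ler0c mulr_ge0 ?sqrtr_ge0.
rewrite -(@ler_pXn2r _ 2) ?nnegrE ?mulr_ge0//.
rewrite (le_trans (povm_form_Cauchy_Schwarz _ _ _))//.
have form_ge0 u : 0 <= povm_form F u u.
  by apply: sumr_ge0 => w _; exact: effect_positive.
rewrite (le_trans (ler_pM _ _ (povm_form_residual_le _ _ x _ Dv1)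
  (povm_form_residual_le _ _ y _ Dv2)))//.
by rewrite mulrACA -rmorphM !exprMn -rmorphXn /= exprMn !sqr_sqrtr.
Qed.

(** Both orders of the product are close to the same effect, that of [D1 :&: D2], which cancels in
    the commutator. *)
Lemma joint_commutator_bound F D1 D2 v1 v2 : 0 <= v1 -> 0 <= v2 ->
  op_bound (event F D1 * (1 - event F D1)) v1 ->
  op_bound (event F D2 * (1 - event F D2)) v2 ->
  op_bound (commutator (event F D1) (event F D2))
    (2 * Num.sqrt v1 * Num.sqrt v2).
Proof.
move=> v10 v20 Dv1 Dv2.
apply: op_bound_of_inner => [|x y]; first by rewrite !mulr_ge0 ?sqrtr_ge0.
rewrite /commutator addOpE oppOpE !mulOpE innerBl.
rewrite (event_symmetric F D1 _ y) (event_symmetric F D2 _ y).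
have le12 := joint_event_bound F D1 D2 v1 v2 x y v10 v20 Dv1 Dv2.
have le21 := joint_event_bound F D2 D1 v2 v1 x y v20 v10 Dv2 Dv1.
rewrite finset.setIC [Num.sqrt v2 * _]mulrC in le21.
rewrite -(mulrA 2) mulr_natl mulr2n rmorphD mulrDl.
apply: le_trans (lerD le12 le21); apply: le_trans (ler_normB _ _).
by rewrite opprB [in leRHS]addrC subrKA.
Qed.

End Povms.

(** * Vector states and the distance between POVMs *)

Section States.
Local Open Scope complex_scope.
Context {R : realType} {H : hilbertType R}.
Implicit Types (x : H).

(** The quotient normalizes any nonzero [x]; at [x = 0] it is 0 by the convention on division, so
    linearity holds for every [x]. *)
Definition vector_functional x (S : boundedOp H) : R[i] :=
  inner (S x) x / inner x x.

Fact vector_functional_scalar x : scalar (vector_functional x).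
Proof.
by move=> a S T; rewrite /vector_functional addOpE innerDl innerZl mulrDl mulrA.
Qed.

HB.instance Definition _ x := GRing.isLinear.Build R[i] (boundedOp H) R[i] *%R
  (vector_functional x) (vector_functional_scalar x).

Lemma vector_functional_state x : x != 0 -> is_state (vector_functional x).
Proof.
move=> x0; have xx : inner x x != 0 by rewrite -normr_inner sqrf_eq0 normr_eq0.
split=> [S S0|]; last exact: divff.
by rewrite /vector_functional divr_ge0 ?inner_ge0// S0.
Qed.

Context {Omega : finType}.
Implicit Types (A : povm H Omega) (D : {set Omega}).

Lemma d1_ge0 (p q : Omega -> R) : 0 <= d1 p q.
Proof. by rewrite mulr_ge0 ?invr_ge0 ?sumr_ge0. Qed.

(* The differences of two distributions on an event and on its complement are
   opposite, which accounts for the factor 1/2 in [d1]. *)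
Lemma le_d1 (p q : Omega -> R) D : \sum_a p a = \sum_a q a ->
  `|\sum_(a in D) (p a - q a)| <= d1 p q.
Proof.
move=> pq; rewrite /d1 [X in _ * X](bigID (mem D)) /= mulrC ler_pdivlMr//.
rewrite mulr_natr mulr2n.
apply: lerD; first exact: ler_norm_sum.
have -> : \sum_(a in D) (p a - q a) = - \sum_(a | a \notin D) (p a - q a).
  apply/eqP; rewrite -addr_eq0 -(bigID (mem D) predT (fun a => p a - q a)) /=.
  by rewrite sumrB pq subrr.
by rewrite normrN; exact: ler_norm_sum.
Qed.

(** This bounds the set under the supremum in [Dd1], so that the supremum dominates its members. *)
Lemma d1_le1 (p q : Omega -> R) :
  (forall a, 0 <= p a) -> (forall a, 0 <= q a) ->
  \sum_a p a = 1 -> \sum_a q a = 1 -> d1 p q <= 1.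
Proof.
move=> p0 q0 p1 q1; rewrite /d1 mulrC ler_pdivrMr// mul1r.
rewrite (_ : 2 = \sum_a (p a + q a)); last by rewrite big_split /= p1 q1.
by apply: ler_sum => a _; rewrite (le_trans (ler_normB _ _))// !ger0_norm.
Qed.

Lemma outcome_prob_ge0 w A a : is_state w -> 0 <= outcome_prob w A a.
Proof.
move=> [w0 _]; rewrite /outcome_prob -lecR RRe_real ?ger0_real ?w0//;
  exact: effect_positive.
Qed.

Lemma outcome_prob_sum w A D :
  \sum_(a in D) outcome_prob w A a = complex.Re (w (event A D)).
Proof. by rewrite /event linear_sum raddf_sum. Qed.

Lemma outcome_prob_sum1 w A : is_state w -> \sum_a outcome_prob w A a = 1.
Proof.
move=> [_ w1]; have := outcome_prob_sum w A [set: Omega].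
by rewrite eventT w1 /= => <-; apply: eq_bigl => a; rewrite inE.
Qed.

Lemma d1_le_Dd1 w A A' : is_state w ->
  d1 (outcome_prob w A) (outcome_prob w A') <= Dd1 A A'.
Proof.
move=> ws; apply: ub_le_sup; last by exists w.
exists 1 => _ [w' /= w's <-].
apply: d1_le1 => [a|a||]; by [exact: outcome_prob_ge0|exact: outcome_prob_sum1].
Qed.

(** In the vector state of [x], the expectation of the difference is a difference of event
    probabilities, to which [le_d1] applies. *)
Lemma event_dist A A' D x :
  `|inner ((event A D - event A' D) x) x| <= (Dd1 A A')%:C * `|x| ^+ 2.
Proof.
have [->|x0] := eqVneq x 0.
  by rewrite (linear0r inner) !normr0 expr0n mulr0.
have ws := vector_functional_state x x0.
have xx0 : inner x x != 0 by rewrite -normr_inner sqrf_eq0 normr_eq0.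
set X := event A D - event A' D; set w := vector_functional x.
have XR : inner (X x) x \is Num.real.
  by rewrite CrealE -inner_conj symmetric_opB//; exact: event_symmetric.
have -> : inner (X x) x = (complex.Re (w X))%:C * inner x x.
  rewrite RRe_real; first by rewrite divfK.
  by rewrite realM ?realV// ger0_real ?inner_ge0.
rewrite normrM normr_inner [`|inner x x|]ger0_norm ?inner_ge0//.
rewrite ler_wpM2r ?inner_ge0//.
rewrite normc_def /= expr0n addr0 sqrtr_sqr lecR.
apply: le_trans (d1_le_Dd1 _ A A' ws).
rewrite /X /w (linearB (vector_functional x)) raddfB /=.
rewrite -!(outcome_prob_sum (vector_functional x)) -sumrB.
by apply: le_d1; rewrite !outcome_prob_sum1.
Qed.

End States.

(** * Bounds for events and for marginals *)

Section CoarseGraining.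
Local Open Scope complex_scope.
Context {R : realType} {H : hilbertType R}.

(** A nonzero vector supplies a state, so the supremum dominates some value of [d1]. *)
Lemma Dd1_ge0 (Omega : finType) (A A' : povm H Omega) :
  (exists v : H, v != 0) -> 0 <= Dd1 A A'.
Proof.
move=> [v v0].
apply: le_trans (d1_le_Dd1 _ A A' (vector_functional_state v v0)).
exact: d1_ge0.
Qed.

Lemma V1_ge0 (Omega : finType) (A : povm H Omega) : 0 <= V1 A.
Proof. by rewrite /V1 bigmax_ge_id. Qed.

Lemma V1_bound (Omega : finType) (A : povm H Omega) (D : {set Omega}) :
  op_bound (event A D * (1 - event A D)) (V1 A).
Proof. by apply: op_boundW (opnorm_bound _); exact: le_bigmax. Qed.

Lemma event_dist_bound (Omega : finType) (A A' : povm H Omega)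
    (D : {set Omega}) :
  (exists v : H, v != 0) -> op_bound (event A D - event A' D) (Dd1 A A').
Proof.
move=> H0; apply: numerical_range_bound; first exact: Dd1_ge0.
  by apply: symmetric_opB; exact: event_symmetric.
exact: event_dist.
Qed.

(** Events of both marginals become events of the single POVM [F], where the joint estimate
    applies. *)
Lemma event_pushforward (Omega Omega' : finType) (f : Omega -> Omega')
    (F : povm H Omega) (D : {set Omega'}) :
  event (pushforward f F) D = event F (f @^-1: D).
Proof.
rewrite /event (partition_big f (mem D)) /= => [|w]; last by rewrite inE.
apply: eq_bigr => y yD; apply: eq_bigl => w; rewrite inE.
by case: eqP => [->|]; rewrite ?yD ?andbF.
Qed.

Lemma commutator_event (OmegaA OmegaB : finType) (A : povm H OmegaA)
    (B : povm H OmegaB) (DA : {set OmegaA}) (DB : {set OmegaB}) :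
  \sum_(a in DA) \sum_(b in DB) commutator (A a) (B b) =
  commutator (event A DA) (event B DB).
Proof.
rewrite /commutator /event mulr_suml [X in _ - X]mulr_sumr -sumrB.
by apply: eq_bigr => a _; rewrite mulr_sumr mulr_suml -sumrB.
Qed.

End CoarseGraining.

(** * The trade-off between approximation errors and noncommutativity *)

Theorem theorem2 (R : realType) (H : hilbertType R)
    (H_nonzero : exists v : H, v != 0)
    (OmegaA OmegaB : finType) (A : povm H OmegaA) (B : povm H OmegaB)
    (Omega : finType) (F : povm H Omega)
    (fA : Omega -> OmegaA) (fB : Omega -> OmegaB) :
  2 * Dd1 A (pushforward fA F) * Dd1 B (pushforward fB F)
    + Dd1 A (pushforward fA F) + Dd1 B (pushforward fB F)
    + 2 * Num.sqrt (2 * Dd1 A (pushforward fA F) + V1 A)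
        * Num.sqrt (2 * Dd1 B (pushforward fB F) + V1 B)
  >= \big[Num.max/0]_(DeltaA : {set OmegaA})
       \big[Num.max/0]_(DeltaB : {set OmegaB})
         opnorm (\sum_(a in DeltaA) \sum_(b in DeltaB) commutator (A a) (B b)).
Proof.
set dA := Dd1 A _; set dB := Dd1 B _.
have dA0 : 0 <= dA by exact: Dd1_ge0.
have dB0 : 0 <= dB by exact: Dd1_ge0.
set c := (X in _ <= X).
(* Both maxima start from 0, and [opnorm_le] asks for a nonnegative bound. *)
have c0 : 0 <= c by rewrite /c !addr_ge0 ?mulr_ge0 ?sqrtr_ge0.
apply: bigmax_le => // DA _; apply: bigmax_le => // DB _.
rewrite commutator_event; apply: opnorm_le => //.
set A' := event (pushforward fA F) DA; set B' := event (pushforward fB F) DB.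
have distA : op_bound (event A DA - A') dA by exact: event_dist_bound.
have distB : op_bound (event B DB - B') dB by exact: event_dist_bound.
have effA' : is_effect A' by exact: event_effect.
have varA : op_bound (A' * (1 - A')) (2 * dA + V1 A).
  apply: (effect_var_bound (event A DA)) => //; first exact: event_effect.
  exact: V1_bound.
have varB : op_bound (B' * (1 - B')) (2 * dB + V1 B).
  apply: (effect_var_bound (event B DB)) => //; try exact: event_effect.
  exact: V1_bound.
(* The middle term is written with a minus sign so that the effect [A'] is the second argument, as
   in [commutator_effect_bound]. *)
have -> : commutator (event A DA) (event B DB) =
    commutator (event A DA - A') (event B DB) -
    commutator (event B DB - B') A' + commutator A' B'.
  rewrite opprB -[A' * _ - _]/(commutator _ _) commutatorBl commutatorBr.
  by rewrite subrKA subrK.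
have joint : op_bound (commutator A' B')
    (2 * Num.sqrt (2 * dA + V1 A) * Num.sqrt (2 * dB + V1 B)).
  rewrite /A' /B' !event_pushforward in varA varB *.
  by apply: joint_commutator_bound => //; rewrite addr_ge0 ?mulr_ge0 ?V1_ge0.
apply: op_boundW (op_boundD (op_boundD
  (commutator_effect_bound _ _ _ dA0 distA (event_effect B DB))
  (op_boundN (commutator_effect_bound _ _ _ dB0 distB effA'))) joint).
(* The three bounds add up to all of [c] but [2 * dA * dB], which is nonnegative. *)
by rewrite lerD2r lerD2r lerDr !mulr_ge0.
Qed.
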